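(* Let $\mathcal{A}$, $\mathcal{B}$ be unital $C^{\ast}$-algebras and let $\mathcal{H}$ be a space that is both a Hilbert $\mathcal{A}$-module $(\mathcal{H},\mathcal{A},\langle\cdot,\cdot\rangle_{\mathcal{A}})$ and a Hilbert $\mathcal{B}$-module $(\mathcal{H},\mathcal{B},\langle\cdot,\cdot\rangle_{\mathcal{B}})$. Let $\varphi:\mathcal{A}\to\mathcal{B}$ be a $\ast$-homomorphism and $\theta$ a map on $\mathcal{H}$ such that $\langle\theta x,\theta y\rangle_{\mathcal{B}}=\varphi(\langle x,y\rangle_{\mathcal{A}})$ for all $x,y\in\mathcal{H}$. Let $I$ be a countable index set and suppose $\{\Lambda_{i}\}_{i\in I}\subset End_{\mathcal{A}}^{\ast}(\mathcal{H},V_{i})$, where $V_i=\mathcal{H}$ for each $i\in I$, is a $\ast$-g-frame for $(\mathcal{H},\mathcal{A},\langle\cdot,\cdot\rangle_{\mathcal{A}})$ with $\ast$-g-frame operator $S_{\mathcal{A}}$ and lower and upper $\ast$-g-frame bounds $A$, $B$ respectively. If $\theta$ is surjective and $\theta\Lambda_{i}=\Lambda_{i}\theta$ for each $i\in I$, then $\{\Lambda_{i}\}_{i\in I}$ is a $\ast$-g-frame for $(\mathcal{H},\mathcal{B},\langle\cdot,\cdot\rangle_{\mathcal{B}})$ with $\ast$-g-frame operator $S_{\mathcal{B}}$ and lower and upper $\ast$-g-frame bounds $\varphi(A)$, $\varphi(B)$ respectively, and $\langle S_{\mathcal{B}}\theta x,\theta y\rangle_{\mathcal{B}}=\varphi(\langle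 S_{\mathcal{A}}x,y\rangle_{\mathcal{A}})$ for all $x,y\in\mathcal{H}$.
   Context: A Hilbert $\mathcal{C}$-module (for a unital $C^\ast$-algebra $\mathcal{C}$) is a left $\mathcal{C}$-module with a $\mathcal{C}$-valued inner product (linear in the first argument, $\langle cx,y\rangle=c\langle x,y\rangle$, $\langle x,y\rangle=\langle y,x\rangle^\ast$, positive definite), complete for $\|x\|=\|\langle x,x\rangle\|^{1/2}$. $End_{\mathcal{C}}^{\ast}(\mathcal{H},V)$ denotes adjointable maps $T$ (there is $T^\ast$ with $\langle Tx,y\rangle=\langle x,T^\ast y\rangle$). An element $c\in\mathcal{C}$ is strictly nonzero if $0\notin sp(c)$. A family $\{\Lambda_i\}_{i\in I}$ of adjointable maps from a Hilbert $\mathcal{C}$-module $\mathcal{H}$ to Hilbert $\mathcal{C}$-modules $V_i$ is a $\ast$-g-frame with lower and upper bounds $A,B$ if $A,B$ are strictly nonzero elements of $\mathcal{C}$ and for all $x\in\mathcal{H}$, $A\langle x,x\rangle A^{\ast}\le\sum_{i\in I}\langle\Lambda_i x,\Lambda_i x\rangle\le B\langle x,x\rangle B^{\ast}$ (the series converging); its $\ast$-g-frame operator is $Sx=\sum_{i\in I}\Lambda_i^\ast\Lambda_i x$, with adjoints taken with respect to the relevant inner product.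
   Formalization: The ∗-homomorphism φ is assumed unital, φ(1)=1; without this the claim is false, since φ(A) strictly nonzero forces φ(1)=1 (e.g. φ: C→C², φ(l)=(l,0), H=C, θ=id, Λ=id). *)

(* Defs.v *)
From mathcomp Require Import all_boot all_algebra.
From mathcomp Require Import complex.
From mathcomp Require Import all_classical all_reals all_analysis.
Import GRing.Theory Num.Theory.
Import numFieldNormedType.Exports.

Set Implicit Arguments.
Unset Strict Implicit.
Unset Printing Implicit Defensive.

Local Open Scope ring_scope.
Local Open Scope complex_scope.

Record CstarAlgebra (R : realType) := {
  ca_car :> completeNormedModType R[i];
  ca_mul : ca_car -> ca_car -> ca_car;
  ca_one : ca_car;
  ca_star : ca_car -> ca_car;
  ca_mulA : forall x y z, ca_mul x (ca_mul y z) = ca_mul (ca_mul x y) z;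
  ca_mul1l : forall x, ca_mul ca_one x = x;
  ca_mul1r : forall x, ca_mul x ca_one = x;
  ca_mulDl : forall x y z, ca_mul (x + y) z = ca_mul x z + ca_mul y z;
  ca_mulDr : forall x y z, ca_mul x (y + z) = ca_mul x y + ca_mul x z;
  ca_mulZl : forall (c : R[i]) x y, ca_mul (c *: x) y = c *: ca_mul x y;
  ca_mulZr : forall (c : R[i]) x y, ca_mul x (c *: y) = c *: ca_mul x y;
  ca_starD : forall x y, ca_star (x + y) = ca_star x + ca_star y;
  ca_starZ : forall (c : R[i]) x, ca_star (c *: x) = Num.conj c *: ca_star x;
  ca_starK : forall x, ca_star (ca_star x) = x;
  ca_starM : forall x y, ca_star (ca_mul x y) = ca_mul (ca_star y) (ca_star x);
  ca_norm_mul : forall x y, `|ca_mul x y| <= `|x| * `|y|;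
  ca_cstar : forall x, `|ca_mul (ca_star x) x| = `|x| ^+ 2
}.

Section CstarNotions.
Variables (R : realType) (A : CstarAlgebra R).

Definition cinvertible (a : A) : Prop :=
  exists b : A, ca_mul a b = ca_one A /\ ca_mul b a = ca_one A.

Definition cspectrum (a : A) : set R[i] :=
  [set l | ~ cinvertible (a - l *: ca_one A)].

Definition strictly_nonzero (a : A) : Prop := ~ cspectrum a 0.

Definition cpositive (a : A) : Prop :=
  ca_star a = a /\ (forall l, cspectrum a l -> 0 <= l).

Definition cle (a b : A) : Prop := cpositive (b - a).

Definition has_sumC (I : eqType) (f : I -> A) (s : A) : Prop :=
  forall e : R[i], 0 < e -> exists F0 : seq I, forall F : seq I,
    uniq F -> {subset F0 <= F} -> `|s - \sum_(i <- F) f i| < e.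

End CstarNotions.

Definition is_star_hom (R : realType) (A B : CstarAlgebra R) (phi : A -> B) : Prop :=
  [/\ forall x y, phi (x + y) = phi x + phi y,
      forall (c : R[i]) x, phi (c *: x) = c *: phi x,
      forall x y, phi (ca_mul x y) = ca_mul (phi x) (phi y),
      forall x, phi (ca_star x) = ca_star (phi x)
    & phi (ca_one A) = ca_one B].

Record HilbertModule (R : realType) (A : CstarAlgebra R) (H : lmodType R[i]) := {
  hm_act : A -> H -> H;
  hm_ip : H -> H -> A;
  hm_act1 : forall x, hm_act (ca_one A) x = x;
  hm_actM : forall a b x, hm_act a (hm_act b x) = hm_act (ca_mul a b) x;
  hm_actDl : forall a b x, hm_act (a + b) x = hm_act a x + hm_act b x;
  hm_actDr : forall a x y, hm_act a (x + y) = hm_act a x + hm_act a y;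
  hm_actZl : forall (c : R[i]) a x, hm_act (c *: a) x = c *: hm_act a x;
  hm_actZr : forall (c : R[i]) a x, hm_act a (c *: x) = c *: hm_act a x;
  hm_ipDl : forall x y z, hm_ip (x + y) z = hm_ip x z + hm_ip y z;
  hm_ipZl : forall (c : R[i]) x y, hm_ip (c *: x) y = c *: hm_ip x y;
  hm_ipAl : forall a x y, hm_ip (hm_act a x) y = ca_mul a (hm_ip x y);
  hm_ipC : forall x y, hm_ip x y = ca_star (hm_ip y x);
  hm_ip_pos : forall x, cpositive (hm_ip x x);
  hm_ip_def : forall x, hm_ip x x = 0 -> x = 0;
  (* completeness for ||x|| = ||<x,x>||^(1/2)  (stated with ||x||^2) *)
  hm_complete : forall u : nat -> H,
    (forall e : R[i], 0 < e -> exists N, forall m n, (N <= m)%N -> (N <= n)%N ->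
        `|hm_ip (u m - u n) (u m - u n)| < e) ->
    exists l : H, forall e : R[i], 0 < e -> exists N, forall n, (N <= n)%N ->
        `|hm_ip (u n - l) (u n - l)| < e
}.

Section HilbertNotions.
Variables (R : realType) (A : CstarAlgebra R) (H : lmodType R[i])
          (M : HilbertModule A H).

Definition hnorm2 (x : H) : R[i] := `|hm_ip M x x|.

Definition has_sumH (I : eqType) (f : I -> H) (s : H) : Prop :=
  forall e : R[i], 0 < e -> exists F0 : seq I, forall F : seq I,
    uniq F -> {subset F0 <= F} -> hnorm2 (s - \sum_(i <- F) f i) < e.

Definition is_adjoint (T Ts : H -> H) : Prop :=
  forall x y, hm_ip M (T x) y = hm_ip M x (Ts y).

Definition adjointable (T : H -> H) : Prop := exists Ts, is_adjoint T Ts.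

Definition is_star_gframe (I : eqType) (L : I -> H -> H) (a b : A) : Prop :=
  [/\ strictly_nonzero a, strictly_nonzero b,
      forall i, adjointable (L i)
    & forall x, exists s : A,
        [/\ has_sumC (fun i => hm_ip M (L i x) (L i x)) s,
            cle (ca_mul a (ca_mul (hm_ip M x x) (ca_star a))) s
          & cle s (ca_mul b (ca_mul (hm_ip M x x) (ca_star b)))]].

Definition is_gframe_operator (I : eqType) (L : I -> H -> H) (S : H -> H) : Prop :=
  forall Ls : I -> H -> H, (forall i, is_adjoint (L i) (Ls i)) ->
    forall x, has_sumH (fun i => Ls i (L i x)) (S x).

End HilbertNotions.

(* Main.v *)
(* A unital *-homomorphism [phi] is bounded for an algebraic reason: a
   self-adjoint [g] of norm at most 1/2 satisfies [g^2 + s^2 = 1] for some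
   self-adjoint [s] commuting with [g], and this relation, preserved by [phi],
   forces [phi g] to have norm at most 1. As [theta] is surjective and carries
   one inner product to the image under [phi] of the other, it is additive, the
   B-adjoint of [L i] sends [theta y] to the image under [theta] of the A-adjoint
   at [y], and [theta] transports norm-convergent sums. Hence [theta (SA x)] is a
   sum of the series defining [SB (theta x)].

   That sums in a Hilbert module are unique follows from the parallelogram
   identity, once one knows that a positive [p] for which [p + q] can be made
   arbitrarily small with [q] positive must vanish. Positivity being defined by
   the spectrum, this is reduced to the existence of square roots of [q + l] for
   arbitrarily small [l > 0], which needs neither the spectral radius formula nor
   the functional calculus. *)
Require Import Defs.
From mathcomp Require Import all_boot all_algebra.
From mathcomp Require Import complex.
From mathcomp Require Import all_classical all_reals all_analysis.
From mathcomp Require Import lra.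
Import order.Order.TTheory GRing.Theory Num.Theory.
Import numFieldNormedType.Exports.
Set Implicit Arguments.
Unset Strict Implicit.
Unset Printing Implicit Defensive.
Local Open Scope ring_scope.
Local Open Scope complex_scope.

(** * Norms as real numbers *)

Section RealNorm.
Variables (R : realType) (V : normedModType R[i]).
Implicit Types x y : V.

(** Norms take values in [R[i]]; passing to the real part gives access to real linear and nonlinear
    arithmetic. *)
Definition rnorm x : R := complex.Re `|x|.

Lemma norm_rnorm x : `|x| = (rnorm x)%:C.
Proof. by rewrite RRe_real// ger0_real. Qed.

Lemma rnorm_ge0 x : 0 <= rnorm x.
Proof. by rewrite -ler0c -norm_rnorm. Qed.

Lemma rnorm0 : rnorm 0 = 0.
Proof. by rewrite /rnorm normr0. Qed.

Lemma rnorm_eq0 x : rnorm x = 0 -> x = 0.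
Proof. by move=> x0; apply/normr0_eq0; rewrite norm_rnorm x0. Qed.

Lemma rnormD x y : rnorm (x + y) <= rnorm x + rnorm y.
Proof. by rewrite -lecR rmorphD/= -!norm_rnorm ler_normD. Qed.

Lemma rnormN x : rnorm (- x) = rnorm x.
Proof. by rewrite /rnorm normrN. Qed.

Lemma rnormB x y : rnorm (x - y) <= rnorm x + rnorm y.
Proof. by rewrite -(rnormN y) rnormD. Qed.

Lemma rnormZ (k : R) x : 0 <= k -> rnorm (k%:C *: x) = k * rnorm x.
Proof.
move=> k0; apply: (@complexI R).
by rewrite rmorphM/= -!norm_rnorm normrZ ger0_norm// ler0c.
Qed.

Lemma rnorm_mulrn x n : rnorm (x *+ n) = rnorm x *+ n.
Proof.
by rewrite -scaler_nat -(rmorph_nat (real_complex R)) rnormZ ?ler0n// mulr_natl.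
Qed.

Lemma eq0_rnorm_lt x : (forall e : R, 0 < e -> rnorm x < e) -> x = 0.
Proof.
move=> small; apply/rnorm_eq0/eqP; rewrite eq_le rnorm_ge0 andbT leNgt.
by apply/negP => /small; rewrite ltxx.
Qed.

End RealNorm.

(** * Fixed points of contractions of ratio 1/2 *)

Section Contraction.
Variables (R : realType) (V : completeNormedModType R[i]).

Lemma geometric_cauchy_cvg (C : R) (u : nat -> V) :
  (forall n, rnorm (u n.+1 - u n) <= C / 2 ^+ n) ->
  exists l, forall e : R, 0 < e ->
    exists N, forall n, (N <= n)%N -> rnorm (u n - l) < e.
Proof.
move=> Cu.
have C0 : 0 <= C by have := le_trans (rnorm_ge0 _) (Cu 0); rewrite expr0 divr1.
(* The exact geometric partial sum, rather than the bound [2 * C / 2 ^+ n], makes the induction on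
   [m] close. *)
have dist n m : rnorm (u (n + m)%N - u n) <= 2 * C / 2 ^+ n - 2 * C / 2 ^+ (n + m).
  elim: m => [|m ih]; first by rewrite addn0 !subrr rnorm0.
  rewrite -[u (n + m.+1)%N](subrK (u (n + m)%N)) -addrA.
  apply: le_trans (rnormD _ _) _; rewrite addnS.
  apply: le_trans (lerD (Cu _) ih) _.
  rewrite exprS invfM; lra.
have small (e : R) : 0 < e -> exists N, 2 * C / 2 ^+ N < e.
  move=> e0; have [N /= eN] : exists N, 2 * C / e < 2 ^+ N :> R.
    exists (Num.Def.archi_bound (2 * C / e)).
    apply: lt_trans (archi_boundP _) _.
      by rewrite divr_ge0 ?mulr_ge0 ?ler0n ?(ltW e0).
    by rewrite -natrX ltr_nat ltn_expl.
  by exists N; move: eN; rewrite !ltr_pdivrMr ?exprn_gt0// [e * _]mulrC.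
have cvgu : cvgn u.
  apply: cauchy_cvg; apply: cauchy_exP => eps eps0.
  have epsE : eps = (complex.Re eps)%:C by rewrite RRe_real// gtr0_real.
  have [N NP] := small (complex.Re eps) ltac:(by rewrite -ltcR -epsE).
  exists (u N); exists N => // n /= Nn.
  rewrite -ball_normE /= -opprB normrN norm_rnorm epsE ltcR -(subnKC Nn).
  apply: le_lt_trans (dist _ _) _; apply: le_lt_trans NP.
  by rewrite gerBl divr_ge0 ?mulr_ge0 ?exprn_ge0.
exists (limn u) => e e0.
have e0C : 0 < e%:C by rewrite ltcR.
have [N _ NP] := @cvgr_dist_lt _ _ _ _ _ u (limn u) cvgu _ e0C.
exists N => n Nn; have := NP n Nn.
by rewrite -opprB normrN norm_rnorm ltcR.
Qed.

(** The invariant set [D], closed under limits, is how a fixed point inherits norm bounds,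
    self-adjointness and commutation from the iterates. *)
Lemma contraction_fixpoint (D : V -> Prop) (f : V -> V) (x0 : V) :
  D x0 -> (forall x, D x -> D (f x)) ->
  (forall x y, D x -> D y -> rnorm (f x - f y) <= 2^-1 * rnorm (x - y)) ->
  (forall l, (forall e : R, 0 < e -> exists2 x, D x & rnorm (x - l) < e) -> D l) ->
  exists2 l, D l & f l = l.
Proof.
move=> Dx0 fD lip Dcl; pose u n := iter n f x0.
have Du n : D (u n) by elim: n => //= n /fD.
have [l ul] : exists l, forall e : R, 0 < e ->
    exists N, forall n, (N <= n)%N -> rnorm (u n - l) < e.
  apply: (@geometric_cauchy_cvg (rnorm (u 1%N - u 0))).
  elim=> [|n ih]; first by rewrite expr0 divr1.
  apply: le_trans (lip _ _ (Du n.+1) (Du n)) _.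
  by rewrite exprS invfM mulrCA ler_wpM2l.
have Dl : D l.
  by apply: Dcl => e /ul[N /(_ N (leqnn _))]; exists (u N).
exists l => //; apply/subr0_eq/eq0_rnorm_lt => e e0.
have [N NP] := ul (e / 2) ltac:(lra).
have -> : f l - l = (f l - f (u N)) + (u N.+1 - l) by rewrite addrA subrK.
apply: le_lt_trans (rnormD _ _) _.
have := lip _ _ Dl (Du N); rewrite -[rnorm (l - _)]rnormN opprB.
have := NP N (leqnn _); have := NP N.+1 (leqnSn _).
have := rnorm_ge0 (u N - l).
lra.
Qed.

End Contraction.

Local Notation "x ** y" := (ca_mul x y) (at level 40, left associativity).

(** * Inverses and square roots near the unit of a C*-algebra *)

Section CstarTheory.
Variables (R : realType) (A : CstarAlgebra R).
Implicit Types x y z p q r s w : A.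
Local Notation one := (ca_one A).

Lemma ca_mulNl x y : (- x) ** y = - (x ** y).
Proof. by rewrite -[- x]scaleN1r ca_mulZl scaleN1r. Qed.

Lemma ca_mulNr x y : x ** (- y) = - (x ** y).
Proof. by rewrite -[- y]scaleN1r ca_mulZr scaleN1r. Qed.

Lemma ca_mulBl x y z : (x - y) ** z = x ** z - y ** z.
Proof. by rewrite ca_mulDl ca_mulNl. Qed.

Lemma ca_mulBr x y z : z ** (x - y) = z ** x - z ** y.
Proof. by rewrite ca_mulDr ca_mulNr. Qed.

Lemma ca_starN x : ca_star (- x) = - ca_star x.
Proof. by rewrite -[- x]scaleN1r ca_starZ rmorphN1 scaleN1r. Qed.

Lemma ca_starB x y : ca_star (x - y) = ca_star x - ca_star y.
Proof. by rewrite ca_starD ca_starN. Qed.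

Lemma ca_starZr (k : R) x : ca_star (k%:C *: x) = k%:C *: ca_star x.
Proof. by rewrite ca_starZ; congr (_ *: _); exact: conjc_real. Qed.

Lemma ca_star1 : ca_star one = one.
Proof.
by have := ca_starM (ca_star one) one; rewrite ca_mul1r ca_starK ca_mul1r.
Qed.

Lemma rnormM x y : rnorm (x ** y) <= rnorm x * rnorm y.
Proof. by rewrite -lecR rmorphM/= -!norm_rnorm ca_norm_mul. Qed.

Lemma rnorm_cstar x : rnorm (ca_star x ** x) = rnorm x ^+ 2.
Proof. by apply: (@complexI R); rewrite rmorphXn/= -!norm_rnorm ca_cstar. Qed.

(** The C*-identity and submultiplicativity bound the square of [rnorm y] by
    [rnorm (ca_star y) * rnorm y]; cancel, then use that the star is an involution. *)
Lemma rnorm_star x : rnorm (ca_star x) = rnorm x.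
Proof.
have le_star y : rnorm y <= rnorm (ca_star y).
  have := rnormM (ca_star y) y; rewrite rnorm_cstar expr2.
  have [y0|] := eqVneq (rnorm y) 0; first by rewrite y0 rnorm_ge0.
  by rewrite neq_lt ltNge rnorm_ge0/= => y0; rewrite ler_pM2r.
by apply/eqP; rewrite eq_le le_star -{2}(ca_starK x) le_star.
Qed.

(** Only an inequality, since the unit of the zero algebra has norm 0. *)
Lemma rnorm1_le : rnorm one <= 1.
Proof.
have := rnorm_cstar one; rewrite ca_star1 ca_mul1l.
have := rnorm_ge0 one; nra.
Qed.

(* With [u = p + i s], [u^* u = p^2 + s^2] and [2 p = u + u^*]. *)
Lemma rnorm_sqr_le_sum_sqr p s :
  ca_star p = p -> ca_star s = s -> p ** s = s ** p ->
  rnorm p ^+ 2 <= rnorm (p ** p + s ** s).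
Proof.
move=> pE sE ps; pose u := p + 'i%C *: s.
have uE : ca_star u = p - 'i%C *: s.
  rewrite ca_starD ca_starZ pE sE -scaleNr; congr (_ + _ *: _).
  by apply/eqP; rewrite eq_complex/= oppr0 !eqxx.
have -> : p ** p + s ** s = ca_star u ** u.
  rewrite uE ca_mulBl !ca_mulDr !ca_mulZl !ca_mulZr ps.
  by rewrite opprD addrA addrK scalerA -expr2 sqr_i scaleN1r opprK.
rewrite rnorm_cstar ler_sqr ?nnegrE ?rnorm_ge0//.
have := rnormD u (ca_star u).
have -> : u + ca_star u = p *+ 2 by rewrite uE addrACA subrr addr0 mulr2n.
rewrite rnorm_star rnorm_mulrn; lra.
Qed.

(** The inverse is the fixed point of [y |-> 1 + x y]; iterating inside the commutant of [x] makes
    it two-sided. *)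
Lemma neumann x : rnorm x <= 2^-1 -> cinvertible (one - x).
Proof.
move=> x2; pose D y := y ** x = x ** y.
have [||||y yD yE] := @contraction_fixpoint R A D (fun y => one + x ** y) 0.
- by rewrite /D -(subrr one) ca_mulBl ca_mulBr ca_mul1l ca_mul1r.
- by move=> y yD; rewrite /D ca_mulDl ca_mulDr ca_mul1l ca_mul1r -ca_mulA yD.
- move=> y z _ _; rewrite opprD addrACA subrr add0r -ca_mulBr.
  by apply: le_trans (rnormM _ _) _; rewrite ler_wpM2r ?rnorm_ge0.
- move=> l lD; apply/subr0_eq/eq0_rnorm_lt => e e0; have [y yD yl] := lD e e0.
  have -> : l ** x - x ** l = x ** (y - l) - (y - l) ** x.
    by rewrite ca_mulBl ca_mulBr yD opprB [RHS]addrC addrA subrK.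
  apply: le_lt_trans (rnormB _ _) _.
  have := rnormM x (y - l); have := rnormM (y - l) x.
  have := rnorm_ge0 x; have := rnorm_ge0 (y - l); nra.
have inv : y - x ** y = one by rewrite -{1}yE addrK.
exists y; split; first by rewrite ca_mulBl ca_mul1l.
by rewrite ca_mulBr ca_mul1r yD.
Qed.

(** This places [y] in the bicommutant of [x], so that roots and inverses built from one element
    commute. *)
Definition bicommutes x y := forall z, z ** x = x ** z -> z ** y = y ** z.

(* [1 - r] is the wanted root as soon as [r = (x + r^2) / 2], and this map is
   contracting on the ball of radius 1/2. *)
Lemma sqrt_1B x : ca_star x = x -> rnorm x <= 2^-1 ->
  exists s, [/\ ca_star s = s, s ** s = one - x & bicommutes x s].
Proof.
move=> xE x2.
pose D r := [/\ rnorm r <= 2^-1, ca_star r = r & bicommutes x r].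
pose f r := (2^-1 : R)%:C *: (x + r ** r).
have [||||r [r2 rE rx] rf] := @contraction_fixpoint R A D f 0.
- split; first by rewrite rnorm0 invr_ge0.
    by rewrite -(subrr one) ca_starB ca_star1.
  by move=> z _; rewrite -(subrr one) ca_mulBl ca_mulBr ca_mul1l ca_mul1r.
- move=> r [r2 rE rx]; split.
  + rewrite rnormZ ?invr_ge0//.
    have := rnormD x (r ** r); have := rnormM r r; have := rnorm_ge0 r; nra.
  + by rewrite ca_starZr ca_starD ca_starM xE rE.
  + move=> z zx; rewrite ca_mulZr ca_mulZl ca_mulDl ca_mulDr zx.
    by rewrite ca_mulA (rx _ zx) -ca_mulA (rx _ zx) ca_mulA.
- move=> r s [r2 _ _] [s2 _ _]; rewrite -scalerBr opprD addrACA subrr add0r.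
  rewrite rnormZ ?invr_ge0// ler_wpM2l ?invr_ge0//.
  have -> : r ** r - s ** s = r ** (r - s) + (r - s) ** s.
    by rewrite ca_mulBl ca_mulBr addrA subrK.
  apply: le_trans (rnormD _ _) _.
  have := rnormM r (r - s); have := rnormM (r - s) s.
  have := rnorm_ge0 (r - s); nra.
- move=> l lD; split.
  + apply/ler_addgt0Pr => e e0; have [r [r2 _ _] rl] := lD e e0.
    have := rnormB r (r - l); rewrite opprB addrC subrK; lra.
  + apply/subr0_eq/eq0_rnorm_lt => e e0.
    have [r [_ rE _] rl] := lD (e / 2) ltac:(lra).
    have -> : ca_star l - l = (r - l) - ca_star (r - l).
      by rewrite ca_starB rE opprB [RHS]addrC addrA subrK.
    have := rnormB (r - l) (ca_star (r - l)); rewrite rnorm_star; lra.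
  + move=> z zx; apply/subr0_eq/eq0_rnorm_lt => e e0.
    (* The commutator of [z] with [r - l] costs at most [2 * rnorm z * rnorm (r - l)]; the added 1
       keeps [k] positive. *)
    pose k := 2 * rnorm z + 1.
    have k0 : 0 < k by rewrite /k; have := rnorm_ge0 z; lra.
    have [r [_ _ rx] rl] := lD (e / k) ltac:(by rewrite divr_gt0).
    have -> : z ** l - l ** z = (r - l) ** z - z ** (r - l).
      by rewrite ca_mulBl ca_mulBr (rx _ zx) opprB [RHS]addrC addrA subrK.
    move: rl; rewrite ltr_pdivlMr// /k.
    have := rnormB ((r - l) ** z) (z ** (r - l)).
    have := rnormM z (r - l); have := rnormM (r - l) z.
    have := rnorm_ge0 z; have := rnorm_ge0 (r - l); nra.
exists (one - r); split.
- by rewrite ca_starB ca_star1 rE.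
- rewrite ca_mulBl !ca_mulBr !ca_mul1l ca_mul1r opprB addrA.
  have -> : x = r *+ 2 - r ** r.
    by rewrite -{1}rf /f scalerMnl -rmorphMn/= -mulr_natr mulVf// scale1r addrK.
  by rewrite mulr2n opprB opprD !addrA; congr (_ - _); rewrite addrAC.
- by move=> z zx; rewrite ca_mulBl ca_mulBr ca_mul1l ca_mul1r rx.
Qed.

End CstarTheory.

(** * Square roots of shifts and limits of positive elements *)

Section Positivity.
Variables (R : realType) (A : CstarAlgebra R).
Implicit Types x y z p q r s v w : A.
Implicit Types k l d e : R.
Local Notation one := (ca_one A).
Local Notation "q [+] l" := (q + l%:C *: one) (at level 50).

Lemma cinvertibleM x y : cinvertible x -> cinvertible y -> cinvertible (x ** y).
Proof.
move=> [x' [xx' x'x]] [y' [yy' y'y]]; exists (y' ** x'); split.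
  by rewrite -ca_mulA (ca_mulA y) yy' ca_mul1l.
by rewrite -ca_mulA (ca_mulA x') x'x ca_mul1l.
Qed.

Lemma inverse_comm x w z :
  x ** w = one -> w ** x = one -> z ** x = x ** z -> z ** w = w ** z.
Proof.
move=> xw wx zx.
by rewrite -[LHS]ca_mul1l -wx -ca_mulA (ca_mulA x) -zx -(ca_mulA z) xw ca_mul1r.
Qed.

Lemma inverse_star x w :
  ca_star x = x -> x ** w = one -> w ** x = one -> ca_star w = w.
Proof.
move=> xE xw wx; rewrite -[LHS]ca_mul1r -xw ca_mulA -xE -ca_starM xw.
by rewrite ca_star1 ca_mul1l.
Qed.

Lemma resolvent_identity x y w v :
  w ** x = one -> y ** v = one -> w - v = w ** (y - x) ** v.
Proof.
by move=> wx yv; rewrite ca_mulBr ca_mulBl -ca_mulA yv ca_mul1r wx ca_mul1l.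
Qed.

Lemma shiftB q k l : (q [+] k) - (q [+] l) = (k - l)%:C *: one.
Proof. by rewrite opprD addrACA subrr add0r rmorphB/= scalerBl. Qed.

Lemma comm_shift z q l : z ** q = q ** z -> z ** (q [+] l) = (q [+] l) ** z.
Proof.
by move=> zq; rewrite ca_mulDl ca_mulDr ca_mulZl ca_mulZr ca_mul1l ca_mul1r zq.
Qed.

Lemma shift_star q l : ca_star q = q -> ca_star (q [+] l) = q [+] l.
Proof. by move=> qE; rewrite ca_starD ca_starZr ca_star1 qE. Qed.

Definition sqrt_shift q l : Prop :=
  exists y, [/\ ca_star y = y, y ** y = q [+] l & bicommutes q y].

(** Write [q + l = l (1 + q / l)]: this [l] makes [q / l] of norm at most 1/2. *)
Lemma sqrt_shift_large q : ca_star q = q -> sqrt_shift q (2 * rnorm q + 1).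
Proof.
move=> qE; set l := 2 * rnorm q + 1.
have l0 : 0 < l by rewrite /l; have := rnorm_ge0 q; lra.
have [||s [sE ss scomm]] := @sqrt_1B _ _ (- (l^-1%:C *: q)).
- by rewrite ca_starN ca_starZr qE.
- rewrite rnormN rnormZ ?invr_ge0 ?(ltW l0)// mulrC ler_pdivrMr// /l.
  have := rnorm_ge0 q; lra.
exists ((Num.sqrt l)%:C *: s); split.
- by rewrite ca_starZr sE.
- rewrite ca_mulZl ca_mulZr scalerA -rmorphM/= -expr2 sqr_sqrtr ?ltW//.
  rewrite ss opprK scalerDr scalerA -rmorphM/= divff ?gt_eqF// scale1r.
  by rewrite addrC.
- move=> z zq; rewrite ca_mulZl ca_mulZr scomm// ca_mulNl ca_mulNr.
  by rewrite ca_mulZl ca_mulZr zq.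
Qed.

(* [q + k = (q + l) (1 - (l - k) w)] with [w] inverse to [q + l]. *)
Lemma sqrt_shift_decr q k l w :
  ca_star q = q -> (q [+] l) ** w = one -> w ** (q [+] l) = one ->
  k <= l -> (l - k) * rnorm w <= 2^-1 -> sqrt_shift q l -> sqrt_shift q k.
Proof.
move=> qE lw wl kl small [y [yE yy yq]].
have wcomm z : z ** q = q ** z -> z ** w = w ** z.
  by move=> /(comm_shift l); exact: inverse_comm.
have wE := inverse_star (shift_star l qE) lw wl.
have [||s [sE ss scomm]] := @sqrt_1B _ _ ((l - k)%:C *: w).
- by rewrite ca_starZr wE.
- by rewrite rnormZ ?subr_ge0.
have sq : bicommutes q s.
  by move=> z /wcomm zw; apply: scomm; rewrite ca_mulZl ca_mulZr zw.
have sy : s ** y = y ** s by apply: yq; symmetry; apply: sq.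
exists (y ** s); split.
- by rewrite ca_starM yE sE.
- rewrite -ca_mulA (ca_mulA s) sy -ca_mulA ss ca_mulA yy ca_mulBr ca_mul1r.
  by rewrite ca_mulZr lw -addrA -scalerBl -rmorphB/= subKr.
- by move=> z zq; rewrite ca_mulA yq// -ca_mulA sq// ca_mulA.
Qed.

(* Were the infimum [m] of the admissible [l] positive, local boundedness of
   the inverse at [m] would carry [sqrt_shift_decr] below [m]. *)
Lemma sqrt_shift_small q e : ca_star q = q ->
  (forall l, 0 < l -> cinvertible (q [+] l)) -> 0 < e ->
  exists l, [/\ 0 < l, l < e & sqrt_shift q l].
Proof.
move=> qE qinv e0; apply: contrapT => none.
pose G : set R := [set l | 0 < l /\ sqrt_shift q l]%classic.
have Ge l : G l -> e <= l.
  by move=> [l0 ql]; rewrite leNgt; apply/negP => le; apply: none; exists l.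
have Ginf : has_inf G.
  split; last by exists e.
  exists (2 * rnorm q + 1); split; last exact: sqrt_shift_large.
  by have := rnorm_ge0 q; lra.
pose m := inf G; have em : e <= m by apply: lb_le_inf => //; case: Ginf.
have [w [mw wm]] := qinv m (lt_le_trans e0 em).
pose W := rnorm w; have W0 : 0 <= W := rnorm_ge0 w.
(* The first bound keeps [m - d] positive. The second gives [d * W <= 1/8], which serves both to
   bound the inverse at [l] and to meet the 1/2 of [sqrt_shift_decr]. *)
pose d := Num.min (m / 2) (8 * (W + 1))^-1.
have d0 : 0 < d by rewrite lt_min invr_gt0; apply/andP; split; lra.
have dm : d <= m / 2 by rewrite ge_min lexx.
have dW : d * (8 * (W + 1)) <= 1.
  by rewrite -ler_pdivlMr ?div1r ?ge_min ?lexx ?orbT//; lra.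
have [l [l0 ql] lm] := inf_adherent d0 Ginf.
have ml : m <= l by apply: ge_inf => //; case: Ginf.
have [v [lv vl]] := qinv l l0.
(* The infimum may not be attained, so the descent starts at [l < m + d]; the resolvent identity
   compares its inverse [v] with [w]. *)
have vW : rnorm v <= 2 * W.
  have /eqP := resolvent_identity wm lv.
  rewrite shiftB ca_mulZr ca_mul1r ca_mulZl subr_eq => /eqP wv.
  have := rnormB w ((l - m)%:C *: (w ** v)).
  rewrite {1}wv addrAC subrr add0r rnormZ ?subr_ge0//.
  have := rnormM w v; rewrite -/W; have := rnorm_ge0 v => v0 wvn vn.
  have : (l - m) * rnorm (w ** v) <= d * (W * rnorm v).
    by apply: ler_pM => //; rewrite ?subr_ge0 ?rnorm_ge0//; move: lm; rewrite -/m; lra.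
  nra.
have : G (m - d).
  split; first lra.
  apply: (sqrt_shift_decr qE lv vl _ _ ql); first lra.
  have : l - (m - d) <= 2 * d by move: lm; rewrite -/m; lra.
  have := rnorm_ge0 v; nra.
move=> /(@ge_inf _ _ Ginf.2); rewrite -/m; lra.
Qed.

(** For [k < l / 2], [y^2 = q + k] and [c^2 = l - k], the squares of [c w] and [y w] add up to
    [w (q + l) w = w]. Hence [(l - k) |w|^2 <= |w|], and [l - k] exceeds [l / 2]. *)
Lemma resolvent_bound q l w : ca_star q = q ->
  (forall k, 0 < k -> cinvertible (q [+] k)) -> 0 < l ->
  (q [+] l) ** w = one -> w ** (q [+] l) = one -> l * rnorm w <= 2.
Proof.
move=> qE qinv l0 lw wl.
have [k [k0 kl [y [yE yy yq]]]] :=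
  sqrt_shift_small qE qinv (divr_gt0 l0 (ltr0Sn R 1)).
have wE := inverse_star (shift_star l qE) lw wl.
have wcomm z : z ** q = q ** z -> z ** w = w ** z.
  by move=> /(comm_shift l); exact: inverse_comm.
have yw : w ** y = y ** w by apply: yq; symmetry; apply: wcomm.
pose c := Num.sqrt (l - k).
have c2 : c * c = l - k by rewrite -expr2 sqr_sqrtr//; lra.
have : rnorm (c%:C *: w) ^+ 2 <=
    rnorm ((c%:C *: w) ** (c%:C *: w) + (y ** w) ** (y ** w)).
  apply: rnorm_sqr_le_sum_sqr.
  - by rewrite ca_starZr wE.
  - by rewrite ca_starM yE wE.
  - by rewrite ca_mulZl ca_mulZr ca_mulA yw.
have -> : (c%:C *: w) ** (c%:C *: w) + (y ** w) ** (y ** w) = w.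
  rewrite ca_mulZl ca_mulZr scalerA -rmorphM/= c2.
  have -> : (y ** w) ** (y ** w) = w ** (q [+] k) ** w.
    by rewrite -{1}yw -ca_mulA (ca_mulA y) yy ca_mulA.
  have -> : (l - k)%:C *: (w ** w) = w ** ((l - k)%:C *: one) ** w.
    by rewrite ca_mulZr ca_mul1r ca_mulZl.
  by rewrite -ca_mulDl -ca_mulDr -(shiftB q) subrK wl ca_mul1l.
rewrite rnormZ ?sqrtr_ge0// exprMn expr2 c2 => ineq.
have := rnorm_ge0 w; rewrite le_eqVlt => /orP[/eqP <-|w0]; first by rewrite mulr0.
have : (l - k) * rnorm w <= 1 by rewrite -(ler_pM2r w0) mul1r -mulrA.
nra.
Qed.

Lemma cpositive_shift q l : cpositive q -> 0 < l -> cinvertible (q [+] l).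
Proof.
move=> [_ qsp] l0; apply: contrapT => ninv.
have : cspectrum q (- l%:C) by rewrite /cspectrum /= scaleNr opprK.
by move/qsp; rewrite oppr_ge0 -[0]/(0%:C) lecR leNgt l0.
Qed.

(* The hypothesis makes [p - l] invertible for every [l > 0], so the spectrum
   of [p] is [0]; then [l - p^2] has a square root for arbitrarily small [l],
   which bounds [p^2] by [l]. *)
Lemma cpositive_limit_opp p : cpositive p ->
  (forall e, 0 < e -> exists2 q, cpositive q & rnorm (p + q) < e) -> p = 0.
Proof.
move=> p_pos lim; have [pE _] := p_pos.
have inv_neg l : 0 < l -> cinvertible (l%:C *: one - p).
  (* As [l * rnorm w <= 2] below, the bound [l / 4] gives [w (p + q)] norm at most 1/2, as [neumann]
     requires. *)
  move=> l0; have [q q_pos pq] := lim (l / 4) ltac:(lra).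
  have [qE _] := q_pos.
  have [w [lw wl]] := cpositive_shift q_pos l0.
  have wl2 : l * rnorm w <= 2.
    by apply: resolvent_bound lw wl => // k; exact: cpositive_shift.
  have -> : l%:C *: one - p = (q [+] l) ** (one - w ** (p + q)).
    rewrite ca_mulBr ca_mul1r ca_mulA lw ca_mul1l.
    by rewrite [p + q]addrC opprD addrACA subrr add0r.
  apply: cinvertibleM; first by exists w.
  apply: neumann; apply: le_trans (rnormM _ _) _.
  have := rnorm_ge0 w; have := rnorm_ge0 (p + q); nra.
have inv_sqr l : 0 < l -> cinvertible (- (p ** p) [+] l).
  move=> l0; have s0 : 0 < Num.sqrt l by rewrite sqrtr_gt0.
  have -> : - (p ** p) [+] l = ((Num.sqrt l)%:C *: one - p) ** (p [+] Num.sqrt l).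
    rewrite ca_mulBl !ca_mulDr !ca_mulZl !ca_mulZr !ca_mul1l ca_mul1r.
    rewrite scalerA -rmorphM/= -expr2 sqr_sqrtr ?ltW// opprD.
    by rewrite [X in _ = _ + X]addrC addrACA subrr add0r addrC.
  by apply: cinvertibleM; [exact: inv_neg | exact: cpositive_shift].
apply: eq0_rnorm_lt => e e0.
have [||l [l0 le [y [yE yy ycomm]]]] :=
    @sqrt_shift_small (- (p ** p)) (e ^+ 2) _ inv_sqr.
- by rewrite ca_starN ca_starM pE.
- by rewrite exprn_gt0.
have py : p ** y = y ** p.
  by apply: ycomm; rewrite ca_mulNr ca_mulNl ca_mulA.
have := rnorm_sqr_le_sum_sqr pE yE py.
rewrite yy addrA subrr add0r rnormZ ?(ltW l0)// => pl.
have : rnorm p ^+ 2 < e ^+ 2.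
  apply: le_lt_trans pl _; have := rnorm1_le A; nra.
by rewrite ltr_pXn2r ?nnegrE ?rnorm_ge0// ltW.
Qed.

End Positivity.

(** * Positivity and boundedness under a unital star homomorphism *)

Section StarHom.
Variables (R : realType) (A B : CstarAlgebra R) (phi : A -> B).
Hypothesis hphi : is_star_hom phi.

Lemma star_hom0 : phi 0 = 0.
Proof. by case: hphi => _ phiZ _ _ _; rewrite -(scale0r 0) phiZ scale0r. Qed.

Lemma star_homB x y : phi (x - y) = phi x - phi y.
Proof.
by case: hphi => phiD phiZ _ _ _; rewrite -[- y]scaleN1r phiD phiZ scaleN1r.
Qed.

Lemma star_hom_sum (I : Type) (s : seq I) (f : I -> A) :
  phi (\sum_(i <- s) f i) = \sum_(i <- s) phi (f i).
Proof.
apply: (big_morph phi); last exact: star_hom0.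
by case: hphi.
Qed.

Lemma star_hom_cinvertible x : cinvertible x -> cinvertible (phi x).
Proof.
case: hphi => _ _ phiM _ phi1 [y [xy yx]]; exists (phi y).
by rewrite -!phiM xy yx phi1.
Qed.

Lemma star_hom_spectrum x l : cspectrum (phi x) l -> cspectrum x l.
Proof.
case: (hphi) => _ phiZ _ _ phi1 nphi /star_hom_cinvertible.
by rewrite star_homB phiZ phi1.
Qed.

Lemma star_hom_cpositive x : cpositive x -> cpositive (phi x).
Proof.
case: (hphi) => _ _ _ phiS _ [xE xsp]; split; first by rewrite -phiS xE.
by move=> l /star_hom_spectrum /xsp.
Qed.

Lemma star_hom_strictly_nonzero x : strictly_nonzero x -> strictly_nonzero (phi x).
Proof. by move=> nx /star_hom_spectrum. Qed.

Lemma star_hom_bounded_selfadjoint h :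
  ca_star h = h -> rnorm (phi h) <= 2 * rnorm h.
Proof.
case: (hphi) => phiD phiZ phiM phiS phi1 hE.
have [h0|] := eqVneq (rnorm h) 0.
  by rewrite (rnorm_eq0 h0) star_hom0 !rnorm0 mulr0.
rewrite neq_lt ltNge rnorm_ge0/= => h0.
(* Rescaling to norm exactly 1/2 makes [g^2] small enough for [1 - g^2] to have a root [s]. *)
pose t := (2 * rnorm h)^-1; have t0 : 0 < t by rewrite invr_gt0; lra.
pose g := t%:C *: h.
have gE : ca_star g = g by rewrite ca_starZr hE.
have g2 : rnorm g = 2^-1.
  by rewrite rnormZ ?(ltW t0)// /t invfM -mulrA mulVf ?mulr1// gt_eqF.
have [||s [sE ss scomm]] := @sqrt_1B _ _ (g ** g).
- by rewrite ca_starM gE.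
- apply: le_trans (rnormM _ _) _; rewrite g2; lra.
have gs : g ** s = s ** g by apply: scomm; rewrite ca_mulA.
have : rnorm (phi g) ^+ 2 <= rnorm (phi g ** phi g + phi s ** phi s).
  by apply: rnorm_sqr_le_sum_sqr; rewrite -?phiS -?phiM ?gE ?sE ?gs.
rewrite -!phiM -phiD ss [g ** g + _]addrC subrK phi1 => pg.
have : rnorm (phi g) <= 1.
  have := rnorm_ge0 (phi g); have := rnorm1_le B; nra.
rewrite phiZ rnormZ ?(ltW t0)// /t mulrC ler_pdivrMr ?mul1r//; lra.
Qed.

(** The self-adjoint case at [x^* x], with the C*-identity on both sides, gives
    [|phi x|^2 <= 2 |x|^2]; the constant 2 is a convenient weakening. *)
Lemma star_hom_bounded x : rnorm (phi x) <= 2 * rnorm x.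
Proof.
case: (hphi) => phiD phiZ phiM phiS phi1.
have := @star_hom_bounded_selfadjoint (ca_star x ** x).
rewrite ca_starM ca_starK phiM phiS !rnorm_cstar => /(_ erefl).
have := rnorm_ge0 x; have := rnorm_ge0 (phi x); nra.
Qed.

End StarHom.

(** * Uniqueness of sums in a Hilbert module *)

Section HilbertModuleTheory.
Variables (R : realType) (A : CstarAlgebra R) (H : lmodType R[i]).
Variable M : HilbertModule A H.
Implicit Types x y z : H.
Local Notation "<( x , y )>" := (hm_ip M x y).

Lemma hm_ipBl x y z : <(x - y, z)> = <(x, z)> - <(y, z)>.
Proof. by rewrite -[- y]scaleN1r hm_ipDl hm_ipZl scaleN1r. Qed.

Lemma hm_ipDr x y z : <(z, x + y)> = <(z, x)> + <(z, y)>.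
Proof. by rewrite hm_ipC hm_ipDl ca_starD -!hm_ipC. Qed.

Lemma hm_ipBr x y z : <(z, x - y)> = <(z, x)> - <(z, y)>.
Proof. by rewrite hm_ipC hm_ipBl ca_starB -!hm_ipC. Qed.

Lemma hm_ip_injl x y : (forall z, <(x, z)> = <(y, z)>) -> x = y.
Proof.
by move=> xy; apply/subr0_eq/(@hm_ip_def _ _ _ M); rewrite hm_ipBl xy subrr.
Qed.

Lemma hm_ip_injr x y : (forall z, <(z, x)> = <(z, y)>) -> x = y.
Proof. by move=> xy; apply: hm_ip_injl => z; rewrite hm_ipC xy -hm_ipC. Qed.

Lemma hm_parallelogram x y :
  <(x - y, x - y)> + <(x + y, x + y)> = (<(x, x)> + <(y, y)>) *+ 2.
Proof.
have expand (a b c d : A) : a - b + (d - c) + (a + b + (c + d)) = (a + d) *+ 2.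
  by rewrite addrACA [a + b]addrC [_ + (b + a)]addrA [_ + (c + d)]addrA !subrK
             mulr2n addrACA.
by rewrite hm_ipBl !hm_ipBr hm_ipDl !hm_ipDr opprB expand.
Qed.

Lemma has_sumH_unique (I : eqType) (f : I -> H) s s' :
  has_sumH M f s -> has_sumH M f s' -> s = s'.
Proof.
move=> fs fs'; apply/subr0_eq/(@hm_ip_def _ _ _ M).
apply: cpositive_limit_opp => [|e e0]; first exact: hm_ip_pos.
(* The parallelogram identity doubles the sum of two such errors, giving [e]. *)
have e4 : 0 < (e / 4)%:C by rewrite ltcR; lra.
have [[F0 F0P] [F1 F1P]] := (fs _ e4, fs' _ e4).
(* A common index list makes one partial sum [t] close to both [s] and [s']. *)
pose F := undup (F0 ++ F1); pose t := \sum_(i <- F) f i.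
exists <(s - t + (s' - t), s - t + (s' - t))>; first exact: hm_ip_pos.
have {1 2}-> : s - s' = s - t - (s' - t) by rewrite opprB addrA subrK.
rewrite hm_parallelogram rnorm_mulrn.
have := rnormD <(s - t, s - t)> <(s' - t, s' - t)>.
have : rnorm <(s - t, s - t)> < e / 4.
  rewrite -ltcR -norm_rnorm; apply: F0P; first exact: undup_uniq.
  by move=> i iF; rewrite mem_undup mem_cat iF.
have : rnorm <(s' - t, s' - t)> < e / 4.
  rewrite -ltcR -norm_rnorm; apply: F1P; first exact: undup_uniq.
  by move=> i iF; rewrite mem_undup mem_cat iF orbT.
lra.
Qed.

End HilbertModuleTheory.

(** * Transport of adjoints, sums and frame operators along [theta] *)

Section Transfer.
Variables (R : realType) (A B : CstarAlgebra R) (H : lmodType R[i]).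
Variables (MA : HilbertModule A H) (MB : HilbertModule B H).
Variables (phi : A -> B) (theta : H -> H).
Hypothesis hphi : is_star_hom phi.
Hypothesis htheta :
  forall x y, hm_ip MB (theta x) (theta y) = phi (hm_ip MA x y).
Hypothesis hsurj : forall y, exists x, theta x = y.

Lemma star_hom_norm x : `|phi x| <= 2 * `|x|.
Proof.
rewrite !norm_rnorm -(rmorph_nat (real_complex R)) -rmorphM/= lecR.
exact: star_hom_bounded.
Qed.

Lemma thetaD x y : theta (x + y) = theta x + theta y.
Proof.
apply: (@hm_ip_injl _ _ _ MB) => z; have [v <-] := hsurj z.
by rewrite hm_ipDl !htheta hm_ipDl; case: hphi.
Qed.

Lemma theta0 : theta 0 = 0.
Proof. by apply: (@addrI _ (theta 0)); rewrite -thetaD !addr0. Qed.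

Lemma thetaB x y : theta (x - y) = theta x - theta y.
Proof. by apply: (@addIr _ (theta y)); rewrite -thetaD !subrK. Qed.

Lemma hnorm2_theta x : hnorm2 MB (theta x) <= 2 * hnorm2 MA x.
Proof. by rewrite /hnorm2 htheta star_hom_norm. Qed.

Lemma has_sumH_theta (I : eqType) (f : I -> H) s :
  has_sumH MA f s -> has_sumH MB (theta \o f) (theta s).
Proof.
move=> fs e e0; have [|F0 F0P] := fs (e / 2); first by rewrite divr_gt0.
exists F0 => F Fu F0F.
rewrite -(big_morph theta thetaD theta0) -thetaB.
by apply: le_lt_trans (hnorm2_theta _) _; rewrite mulrC -ltr_pdivlMr// F0P.
Qed.

Lemma has_sumC_star_hom (I : eqType) (f : I -> A) s :
  has_sumC f s -> has_sumC (phi \o f) (phi s).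
Proof.
move=> fs e e0; have [|F0 F0P] := fs (e / 2); first by rewrite divr_gt0.
exists F0 => F Fu F0F.
rewrite -star_hom_sum// -star_homB//.
by apply: le_lt_trans (star_hom_norm _) _; rewrite mulrC -ltr_pdivlMr// F0P.
Qed.

Section Intertwined.
Variables (T Ts : H -> H).
Hypothesis hcomm : forall x, theta (T x) = T (theta x).
Hypothesis hadj : is_adjoint MA T Ts.

Lemma is_adjoint_theta x y :
  hm_ip MB (T (theta x)) (theta y) = hm_ip MB (theta x) (theta (Ts y)).
Proof. by rewrite -hcomm !htheta hadj. Qed.

Lemma adjointable_theta : adjointable MB T.
Proof.
(* [theta] may fail to be injective; any right inverse [g] will do, since only [theta (g y) = y]
   enters. *)
have [g gK] := choice hsurj; exists (theta \o Ts \o g) => x y.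
by rewrite -{1}(gK x) -{1}(gK y) is_adjoint_theta gK.
Qed.

Lemma adjoint_theta (Ts' : H -> H) y :
  is_adjoint MB T Ts' -> Ts' (theta y) = theta (Ts y).
Proof.
move=> hadj'; apply: (@hm_ip_injr _ _ _ MB) => z; have [x <-] := hsurj z.
by rewrite -hadj' is_adjoint_theta.
Qed.

End Intertwined.

(** Serves both the existence of the B-operator and its formula. The B-adjoints [Ls] are arbitrary
    because [is_gframe_operator] quantifies over all choices. *)
Lemma gframe_operator_theta (I : eqType) (L Ls : I -> H -> H) (SA : H -> H) x :
  (forall i, adjointable MA (L i)) -> is_gframe_operator MA L SA ->
  (forall i y, theta (L i y) = L i (theta y)) ->
  (forall i, is_adjoint MB (L i) (Ls i)) ->
  has_sumH MB (fun i => Ls i (L i (theta x))) (theta (SA x)).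
Proof.
move=> /choice[LsA LsAP] SAP hcomm LsP.
have -> : (fun i => Ls i (L i (theta x))) = theta \o (fun i => LsA i (L i x)).
  apply/funext => i /=.
  by rewrite -hcomm (adjoint_theta (hcomm i) (LsAP i) _ (LsP i)).
by apply: has_sumH_theta; exact: SAP.
Qed.

End Transfer.

Theorem theorem3p3 (R : realType) (A B : CstarAlgebra R) (H : lmodType R[i])
  (MA : HilbertModule A H) (MB : HilbertModule B H)
  (phi : A -> B) (theta : H -> H)
  (hphi : is_star_hom phi)
  (htheta : forall x y, hm_ip MB (theta x) (theta y) = phi (hm_ip MA x y))
  (I : countType) (L : I -> H -> H) (a b : A) (SA : H -> H)
  (hframe : is_star_gframe MA L a b)
  (hSA : is_gframe_operator MA L SA)
  (hsurj : forall y : H, exists x : H, theta x = y)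
  (hcomm : forall i x, theta (L i x) = L i (theta x)) :
  is_star_gframe MB L (phi a) (phi b) /\
  (exists SB : H -> H, is_gframe_operator MB L SB) /\
  (forall SB : H -> H, is_gframe_operator MB L SB ->
     forall x y, hm_ip MB (SB (theta x)) (theta y) = phi (hm_ip MA (SA x) y)).
Proof.
case: hframe => a0 b0 Ladj Lsum.
have LadjB i : adjointable MB (L i).
  have [Ls LsP] := Ladj i; exact: (adjointable_theta htheta hsurj (hcomm i) LsP).
split; last split.
- split; [exact: star_hom_strictly_nonzero | exact: star_hom_strictly_nonzero
         | exact: LadjB |] => u.
  have [x <-] := hsurj u; have [s [sumP lo up]] := Lsum x; exists (phi s).
  case: (hphi) => _ _ phiM phiS _; split.
  + have -> : (fun i => hm_ip MB (L i (theta x)) (L i (theta x))) =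
              phi \o (fun i => hm_ip MA (L i x) (L i x)).
      by apply/funext => i /=; rewrite -!hcomm htheta.
    exact: has_sumC_star_hom.
  + rewrite htheta -phiS -!phiM /cle -star_homB//; exact: star_hom_cpositive.
  + rewrite htheta -phiS -!phiM /cle -star_homB//; exact: star_hom_cpositive.
- have [g gK] := choice hsurj; exists (theta \o SA \o g) => Ls LsP u.
  rewrite -{1}(gK u) /=.
  exact: (gframe_operator_theta hphi htheta hsurj _ Ladj hSA hcomm LsP).
- move=> SB SBP x y; have [Ls LsP] := choice LadjB.
  rewrite -htheta; congr (hm_ip MB _ _).
  (* [SB (theta x)] and [theta (SA x)] are sums of the same series, hence equal. *)
  apply: has_sumH_unique (SBP _ LsP _) _.
  exact: (gframe_operator_theta hphi htheta hsurj _ Ladj hSA hcomm LsP).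
Qed.
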